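(* Let $r$ be a rational function with non-constant numerator for which there are disks $D_1,\ldots,D_L$ as described in the context. Let $\mathfrak P$ be a reproducing kernel Pontryagin space of $\mathbb C^p$-valued functions analytic in $r^{-1}(A(r))$, and assume that $\mathfrak P$ is $R^{(r)}_\alpha$-invariant for every $\alpha\in\Omega(r)\cap A(r)$. Assume moreover that $$[f,R^{(r)}_\beta g]_{\mathfrak P}-[R^{(r)}_\alpha f,g]_{\mathfrak P}+(\alpha-\overline\beta)[R^{(r)}_\alpha f,R^{(r)}_\beta g]_{\mathfrak P}=0$$ for all $\alpha,\beta\in\Omega(r)\cap A(r)$ and all $f,g\in\mathfrak P$. Then there is a $\mathbb C^{Np\times Np}$-valued function $\mathsf N$ analytic in $A(r)$ and such that the reproducing kernel of $\mathfrak P$ is $$K(z,w)=(Z_r(z)\otimes I_p)\,\frac{\mathsf N(r(z))-\mathsf N(r(w))^*}{r(z)-\overline{r(w)}}\,(Z_r(w)\otimes I_p)^*,\qquad z,w\in r^{-1}(A(r))$$ (understood by continuity when $r(z)=\overline{r(w)}$).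
   Context: Setting: $r=P/Q$ with $P,Q$ coprime polynomials, $\deg P\ge\deg Q$, $N=\deg P$. $\mathfrak L(r)$ is the $N$-dimensional linear span of the functions $z\mapsto\frac{r(z)-r(a)}{z-a}$, $a$ a point of analyticity of $r$; $e_1,\ldots,e_N$ is a fixed basis of $\mathfrak L(r)$, and $Z_r(z)=(e_1(z)\ \cdots\ e_N(z))$. $\Omega(r)$ is the set of $\alpha\in\mathbb C$ for which $r(z)=\alpha$ has $N$ pairwise different roots $w_1,\ldots,w_N$. For $\alpha\in\Omega(r)$ and $f$ analytic in a neighborhood of these roots, $$(R^{(r)}_\alpha f)(z)=\frac{f(z)}{r(z)-\alpha}-\sum_{n=1}^N\frac{f(w_n)}{r'(w_n)(z-w_n)},\quad r(z)\ne\alpha,$$ extended analytically across the removable singularities $w_1,\ldots,w_N$. Disks: $D_1,\ldots,D_L$ are pairwise disjoint open disks around the distinct zeros of $r$; neither the $D_\ell$ nor their boundaries contain poles of $r$, and, with $\rho=\min_{s\in\bigcup_\ell\partial D_\ell}|r(s)|$, one has $\{z:|r(z)|<\rho\}\subset\bigcup_\ell D_\ell$. A choice of such disks is fixed, and $A(r)=\mathbb C\setminus\bigcup_{\ell=1}^L r(\partial D_\ell)$. Convention: the functions considered on $r^{-1}(A(r))$ are those of the form $f(z)=(Z_r(z)\otimes I_p)F(r(z))$ with $F$ a $\mathbb C^{Np}$-valued function analytic in $A(r)$. *)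

(* Defs.v *)
From HB Require Import structures.
From mathcomp Require Import all_boot all_order all_algebra sesquilinear spectral.
From mathcomp Require Import complex.
From mathcomp Require mxtens.
From mathcomp Require Import all_classical all_reals all_analysis.

Set Implicit Arguments.
Unset Strict Implicit.
Unset Printing Implicit Defensive.

Import Order.TTheory GRing.Theory Num.Theory.
Import numFieldNormedType.Exports.

Local Open Scope classical_set_scope.
Local Open Scope ring_scope.
Local Open Scope sesquilinear_scope.

(* The definitions below are stated over any [C : numClosedFieldType]; they are
   used with [C := Cplx R].  This type ascription gives R[i] the normed topology
   that the library attaches to numeric closed fields. *)
Definition Cplx (R : realType) : numClosedFieldType := R[i].

(* Complex differentiability at every point of [A], which is open in all uses.
   The scalar field is [C] itself, so that [derivable f z 1] is the existence
   of the complex derivative. *)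
Definition analytic_on (C : numClosedFieldType) (V : normedModType C)
    (A : set C) (f : C -> V) : Prop :=
  forall z, A z -> derivable f z 1.

Section RationalFunction.
Variables (C : numClosedFieldType) (P Q : {poly C}).

(* The value at a pole is junk; all uses are guarded by [Q.[z] != 0]. *)
Definition ratf (z : C) : C := P.[z] / Q.[z].

(* z |-> (r z - r a) / (z - a) with its removable singularity at a removed. *)
Definition diffquot (a z : C) : C :=
  if z == a then derive1 ratf a else (ratf z - ratf a) / (z - a).

(* Membership in the span L(r); only the values off the poles matter. *)
Definition in_L (f : C -> C) : Prop :=
  exists (m : nat) (a c : 'I_m -> C),
    (forall i, Q.[a i] != 0) /\
    (forall z, Q.[z] != 0 -> f z = \sum_i c i * diffquot (a i) z).

Definition basis_of_L (N : nat) (e : 'I_N -> C -> C) : Prop :=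
  [/\ forall i, in_L (e i),
      forall f, in_L f -> exists c : 'I_N -> C,
        forall z, Q.[z] != 0 -> f z = \sum_i c i * e i z
    & forall c : 'I_N -> C,
        (forall z, Q.[z] != 0 -> \sum_i c i * e i z = 0) -> forall i, c i = 0].

Definition level_set (alpha : C) : set C :=
  [set w | Q.[w] != 0 /\ ratf w = alpha].

Definition Omega (N : nat) : set C :=
  [set alpha | exists w : 'I_N -> C,
     injective w /\ forall n, level_set alpha (w n)].

(* For alpha in [Omega N] the level set is exactly {w_1, ..., w_N}. *)
Definition Rformula (p : nat) (alpha : C) (f : C -> 'cV[C]_p) (z : C)
    : 'cV[C]_p :=
  (ratf z - alpha)^-1 *: f z
  - \sum_(w \in level_set alpha) (derive1 ratf w * (z - w))^-1 *: f w.

Definition Rop (p : nat) (alpha : C) (f : C -> 'cV[C]_p) (z : C) : 'cV[C]_p :=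
  if ratf z == alpha then lim (Rformula alpha f x @[x --> z^'])
  else Rformula alpha f z.

Definition circle (c rho : C) : set C := [set z | `|z - c| = rho].

Record disk_system (L : nat) (ctr rad : 'I_L -> C) : Prop := DiskSystem {
  ds_inj : injective ctr;
  ds_zeros : forall z, level_set 0 z <-> exists l, z = ctr l;
  ds_rad : forall l, 0 < rad l;
  ds_disj : forall k l, k != l ->
    ball (ctr k) (rad k) `&` ball (ctr l) (rad l) = set0;
  ds_nopole : forall l z,
    (ball (ctr l) (rad l) `|` circle (ctr l) (rad l)) z -> Q.[z] != 0;
  ds_level : exists rho : C,
    [/\ exists l s, circle (ctr l) (rad l) s /\ `|ratf s| = rho,
        forall l s, circle (ctr l) (rad l) s -> rho <= `|ratf s|
      & forall z, Q.[z] != 0 -> `|ratf z| < rho ->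
          exists l, ball (ctr l) (rad l) z] }.

Definition Aset (L : nat) (ctr rad : 'I_L -> C) : set C :=
  ~` \bigcup_(l in [set: 'I_L]) (ratf @` circle (ctr l) (rad l)).

Definition ratf_preimage (A : set C) : set C :=
  [set z | Q.[z] != 0 /\ A (ratf z)].

End RationalFunction.

(* Z_r(z) (x) I_p with Z_r(z) the row (e_1(z) ... e_N(z)); the cast only
   identifies 1 * p rows with p rows. *)
Definition ZI (C : numClosedFieldType) (N p : nat) (e : 'I_N -> C -> C) (z : C)
    : 'M[C]_(p, N * p) :=
  castmx (mul1n p, erefl) (mxtens.tensmx (\row_i e i z) (1%:M : 'M[C]_p)).

Section Pontryagin.
Variables (C : numClosedFieldType) (V : lmodType C).
Implicit Types (H : set V) (ip : V -> V -> C).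

Definition subspace H : Prop :=
  H 0 /\ forall a f g, H f -> H g -> H (a *: f + g).

(* Linear in the first argument; conjugate-linearity in the second follows. *)
Definition hermitian_on H ip : Prop :=
  (forall a f g h, H f -> H g -> H h ->
     ip (a *: f + g) h = a * ip f h + ip g h) /\
  (forall f g, H f -> H g -> ip g f = (ip f g)^*).

(* Convergence is measured by the squared norm [ip f f]. *)
Definition complete_on H ip : Prop :=
  forall u : nat -> V, (forall n, H (u n)) ->
    (forall eps : C, 0 < eps -> exists M : nat, forall m n : nat,
       (M <= m)%N -> (M <= n)%N -> ip (u m - u n) (u m - u n) < eps) ->
    exists2 l : V, H l &
      forall eps : C, 0 < eps -> exists M : nat, forall n : nat,
        (M <= n)%N -> ip (u n - l) (u n - l) < eps.

Definition finite_dimensional H : Prop :=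
  exists (m : nat) (b : 'I_m -> V),
    forall f, H f -> exists c : 'I_m -> C, f = \sum_i c i *: b i.

Definition pontryagin_decomposition H ip (Hp Hm : set V) : Prop :=
  [/\ [/\ subspace Hp, Hp `<=` H,
          forall f, Hp f -> f != 0 -> 0 < ip f f & complete_on Hp ip],
      [/\ subspace Hm, Hm `<=` H,
          forall f, Hm f -> f != 0 -> ip f f < 0 & finite_dimensional Hm],
      forall f g, Hp f -> Hm g -> ip f g = 0
    & forall f, H f -> exists fp fm, [/\ Hp fp, Hm fm & f = fp + fm]].

Definition pontryagin_space H ip : Prop :=
  [/\ subspace H, hermitian_on H ip
    & exists Hp Hm, pontryagin_decomposition H ip Hp Hm].

End Pontryagin.

(* A function on [U] is represented by its extension by zero to all of [C], so
   that equality of functions on [U] is equality of the representatives. *)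
Definition on_dom (C : numClosedFieldType) (p : nat) (U : set C)
    (f : C -> 'cV[C]_p) : C -> 'cV[C]_p :=
  patch (fun=> 0) U f.

(* [K(.,w)c] lies in H and [f, K(.,w)c] = c^* f(w). *)
Definition reproducing_kernel (C : numClosedFieldType) (p : nat) (U : set C)
    (H : set (C -> 'cV[C]_p)) (ip : (C -> 'cV[C]_p) -> (C -> 'cV[C]_p) -> C)
    (K : C -> C -> 'M[C]_p) : Prop :=
  forall w (c : 'cV[C]_p), U w ->
    H (on_dom U (fun z => K z w *m c)) /\
    forall f, H f ->
      ip f (on_dom U (fun z => K z w *m c)) = (c ^t* *m f w) 0 0.

(* The functions considered on r^{-1}(A). *)
Definition admissible (C : numClosedFieldType) (P Q : {poly C}) (N p : nat)
    (e : 'I_N -> C -> C) (A : set C) (f : C -> 'cV[C]_p) : Prop :=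
  [/\ on_dom (ratf_preimage P Q A) f = f,
      analytic_on (ratf_preimage P Q A) f
    & exists F : C -> 'cV[C]_(N * p),
        analytic_on A F /\
        forall z, ratf_preimage P Q A z -> f z = ZI p e z *m F (ratf P Q z)].

Definition nquot (C : numClosedFieldType) (m : nat) (Nf : C -> 'M[C]_m)
    (lambda omega : C) : 'M[C]_m :=
  (lambda - omega^*)^-1 *: (Nf lambda - (Nf omega) ^t*).

(* Main.v *)
Require Import Defs.
From HB Require Import structures.
From mathcomp Require Import all_boot all_order all_algebra sesquilinear spectral.
From mathcomp Require Import complex.
From mathcomp Require mxtens separable.
From mathcomp Require Import all_classical all_reals all_analysis.
From mathcomp Require Import ring.

Set Implicit Arguments.
Unset Strict Implicit.
Unset Printing Implicit Defensive.

Import Order.TTheory GRing.Theory Num.Theory.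
Import numFieldNormedType.Exports.

Local Open Scope classical_set_scope.
Local Open Scope ring_scope.
Local Open Scope sesquilinear_scope.

(** The idea is that a single well-chosen real point [beta] determines the
    whole kernel.

    The exceptional values of [r] (critical values, and the value at infinity)
    are finitely many, and [r] is bounded on the circles, so some natural number
    [beta] lies in [Omega] and in [A] ([Aset_nat], [exceptionalP]).  Taking
    [alpha = beta] in the hypothesis, and using that [beta] is real, says that
    R_beta is self-adjoint.

    Let w_1, ..., w_N be the roots of [r = beta].  The functions
      l_n(z) = (r(z) - beta) / (r'(w_n) (z - w_n))
    belong to L(r) by the very definition of that space, hence
    [l_n(z) I_p = ZI z *m X_n] for constant matrices [X_n].  Therefore
      (R_beta f)(z) = (f(z) - ZI z *m sum_n X_n f(w_n)) / (r(z) - beta)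
    ([Rop_interpolation]), and l_n(w_m) is 1 if m = n and 0 otherwise
    ([interpolation_node]).  Writing S(w) = sum_n X_n K(w_n, w) and testing
    self-adjointness on the kernel functions K(., w)c and K(., z)d gives
      (K(z,w) - ZI z S(w)) / (r(z) - beta)
        = (K(z,w) - S(z)^* (ZI w)^* ) / (r(w)^* - beta),
    that is, after clearing denominators,
      (r(z) - r(w)^* ) K(z,w)
        = (r(z) - beta) S(z)^* (ZI w)^* - (r(w)^* - beta) ZI z S(w).
    Since K(., w_n)c has the form [ZI z *m F (r z)] with [F] analytic, the matrix
    (r(z) - beta) S(z)^* is [ZI z *m Nf (r z)] with [Nf] analytic in [A], and the
    formula for [K] is [kernel_identity].

    It remains to treat r(z) = r(w)^*.  The identity then only says that
    [Nf mu - (Nf mu^* )^*] vanishes when compressed between [ZI] at the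
    preimages of [mu] and of [mu^*].  If [mu] and [mu^*] are not exceptional,
    these are N points each, and an element of L(r), being a polynomial of degree
    less than N over Q, is zero once it vanishes at N points; so
    [Nf mu = (Nf mu^* )^*].  As [A] is open ([Aset_nbhs]), the equality extends
    to all [mu] by continuity ([symmetric_of_compressions]).  The difference
    quotient of [Nf] then converges to the derivative, and letting [z' -> z] in
    the formula for [K z' w] gives [K z w] ([kernel_coincidence]). *)

(** * Limits of matrix-valued functions *)

Section MatrixLimits.
Variable C : numClosedFieldType.

Lemma trmxC_mul (m n q : nat) (A : 'M[C]_(m, n)) (B : 'M[C]_(n, q)) :
  (A *m B)^t* = B^t* *m A^t*.
Proof. by rewrite trmx_mul map_mxM. Qed.

Lemma trmxCB (m n : nat) (A B : 'M[C]_(m, n)) : (A - B)^t* = A^t* - B^t*.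
Proof. by apply/matrixP => i j; rewrite !mxE rmorphB. Qed.

Lemma trmxCZ (m n : nat) (a : C) (A : 'M[C]_(m, n)) :
  (a *: A)^t* = a^* *: A^t*.
Proof. by rewrite linearZ /= map_mxZ. Qed.

Lemma cvg_mxP (T : Type) (F : set_system T) (FF : Filter F) (m n : nat)
    (f : T -> 'M[C]_(m, n)) (l : 'M[C]_(m, n)) :
  f @ F --> l <-> forall i j, (fun x => f x i j) @ F --> l i j.
Proof.
split=> [fl i j|fl].
  exact: (cvg_comp f (fun M : 'M[C]_(m, n) => M i j) fl
    (@coord_continuous C m n i j l)).
move=> S [B Bl BS]; rewrite /nbhs /=.
have : \forall x \near F, forall i, forall j, B i j (f x i j).
  apply: filter_forall => i; apply: filter_forall => j.
  exact: (fl i j _ (Bl i j)).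
by apply: filterS => x Bx; apply: BS.
Qed.

Lemma cvg_mulmx (T : Type) (F : set_system T) {FF : Filter F} (m n q : nat)
    (f : T -> 'M[C]_(m, n)) (g : T -> 'M[C]_(n, q))
    (a : 'M[C]_(m, n)) (b : 'M[C]_(n, q)) :
  f @ F --> a -> g @ F --> b -> (fun x => f x *m g x) @ F --> a *m b.
Proof.
move=> /cvg_mxP fa /cvg_mxP gb; apply/cvg_mxP => i j.
rewrite mxE; under eq_fun do rewrite mxE.
by apply: cvg_big => [|k _]; [exact: add_continuous | exact: cvgM].
Qed.

Lemma conj_continuous (z : C) : {for z, continuous (fun x : C => x^*)}.
Proof.
move=> S /nbhs_ballP[eps eps0 epsS]; apply/nbhs_ballP; exists eps => // x.
move=> zx; apply: epsS; move: zx.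
by rewrite -!ball_normE /= -rmorphB norm_conjC.
Qed.

Lemma derivable_mx (m n : nat) (M : C -> 'M[C]_(m, n)) (z : C) :
  (forall i j, derivable (fun x => M x i j) z 1) <-> derivable M z 1.
Proof.
split=> [dM|/cvg_ex[l Ml] i j].
  apply/cvg_ex; exists (\matrix_(i, j) 'D_1 (fun x => M x i j) z).
  apply/cvg_mxP => i j; rewrite mxE; have := dM i j.
  by under [X in _ -> X @ _ --> _]eq_fun do rewrite !mxE.
apply/cvg_ex; exists (l i j); move/cvg_mxP : Ml => /(_ i j).
by under [X in X @ _ --> _ -> _]eq_fun do rewrite !mxE.
Qed.

Lemma cvg_punctured (T : Type) (F : set_system T) (FF : Filter F)
    (g : T -> C) (l : C) :
  g @ F --> l -> (\forall x \near F, g x != l) -> g @ F --> l^'.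
Proof.
by move=> gl gn S /gl; apply: filterS2 gn => x gx; apply.
Qed.

Lemma derivable_cvg_slope (V : normedModType C) (f : C -> V) (z : C) :
  derivable f z 1 -> (x - z)^-1 *: (f x - f z) @[x --> z^'] --> 'D_1 f z.
Proof.
move=> df.
have : (fun x => x - z) @ z^' --> (0 : C)^'.
  apply: cvg_punctured.
    rewrite -(subrr z); apply: cvg_within_filter.
    by apply: cvgB; [exact: cvg_id | exact: cvg_cst].
  by near=> x; rewrite subr_eq0; near: x; exact: nbhs_dnbhs_neq.
move=> /cvg_comp/(_ df); apply: cvg_trans; apply: near_eq_cvg.
near=> x; rewrite /= [_ *: 1]mulr1 subrK.
Unshelve. all: by end_near. Qed.

End MatrixLimits.

(** * The pencil P - a Q and the exceptional values of r *)

Section Pencil.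
Variables (C : numClosedFieldType) (P Q : {poly C}) (N : nat).
Hypotheses (hN : size P = N.+1) (hN0 : (0 < N)%N).
Hypotheses (hPQ : coprimep P Q) (hdeg : (size Q <= size P)%N).

Lemma lead_neq0 : P`_N != 0.
Proof.
by rewrite -[N]/(N.+1.-1) -hN -lead_coefE lead_coef_eq0 -size_poly_gt0 hN.
Qed.

Lemma pencil_neq0 (a : C) : P - a *: Q != 0.
Proof.
apply/eqP => /eqP; rewrite subr_eq0 => /eqP PaQ.
have a0 : a != 0.
  by apply/eqP => a0; move: hN; rewrite PaQ a0 scale0r size_poly0.
move: hPQ hN; rewrite PaQ coprimepZl // coprimepp size_scale // => /eqP ->.
by case: N hN0.
Qed.

Lemma pencil_rootE (a z : C) : Q.[z] != 0 -> 
  ((P - a *: Q).[z] == 0) = (ratf P Q z == a).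
Proof.
move=> Qz; rewrite /ratf !hornerE subr_eq0.
by apply/eqP/eqP => [->|<-]; [rewrite mulfK | rewrite divfK].
Qed.

Lemma pencil_rootP (a z : C) : root (P - a *: Q) z <-> level_set P Q a z.
Proof.
split=> [rz|[Qz rz]]; last by rewrite rootE pencil_rootE // rz.
have Qz : Q.[z] != 0.
  apply/eqP => Qz; move: rz; rewrite rootE !hornerE Qz mulr0 subr0 => Pz.
  by move/coprimep_root: hPQ => /(_ _ Pz); rewrite Qz eqxx.
by split=> //; apply/eqP; rewrite -pencil_rootE.
Qed.

Lemma size_pencil_le (a : C) : (size (P - a *: Q)%R <= N.+1)%N.
Proof.
rewrite (leq_trans (size_polyD _ _)) // geq_max size_polyN hN leqnn /=.
by rewrite (leq_trans (size_scale_leq _ _)) // -hN.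
Qed.

Definition wronskian : {poly C} := P^`() * Q - P * Q^`().

(** If [P' Q = P Q'] then [P] divides [P'] by coprimality, which is impossible
    for a nonconstant polynomial in characteristic zero. *)
Lemma wronskian_neq0 : wronskian != 0.
Proof.
rewrite subr_eq0; apply/eqP => PQ.
have : P %| P^`() by rewrite -(Gauss_dvdpl _ hPQ) PQ dvdp_mulr.
have dP0 : P^`() != 0.
  apply/eqP => /polyP/(_ N.-1); rewrite coef_deriv coef0 prednK // => /eqP.
  by rewrite mulrn_eq0 -leqn0 leqNgt hN0 /= (negPf lead_neq0).
by move/(dvdp_leq dP0); rewrite leqNgt lt_size_deriv // -size_poly_gt0 hN.
Qed.

(** The leading-coefficient ratio is the value of [r] at infinity when
    [deg P = deg Q], where the pencil drops degree; otherwise [Q`_N = 0] and the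
    entry is a harmless 0.  The other entries contain all critical values. *)
Definition exceptional : seq C :=
  P`_N / Q`_N :: map (ratf P Q) (sval (closed_field_poly_normal wronskian)).

(** Away from the exceptional values the pencil keeps its degree N, and a
    multiple root of it would be a zero of the Wronskian, so it splits into N
    simple factors. *)
Lemma exceptionalP (a : C) : a \notin exceptional ->
  exists w : 'I_N -> C,
    [/\ injective w, forall z, level_set P Q a z <-> exists n, z = w n
      & forall n, wronskian.[w n] != 0].
Proof.
rewrite inE negb_or => /andP[alc acrit].
have PN0 := lead_neq0.
have sz : size (P - a *: Q) = N.+1.
  apply/eqP; rewrite eqn_leq size_pencil_le /= ltnNge; apply/negP => /leq_sizeP.
  move=> /(_ N (leqnn _)) /eqP; rewrite !coefE subr_eq0 => /eqP PaQ.
  have QN0 : Q`_N != 0 by apply: contra_neq PN0 => Q0; rewrite PaQ Q0 mulr0.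
  by move: alc; rewrite PaQ mulfK ?eqxx.
have [s Ps] := closed_field_poly_normal (P - a *: Q).
have lc0 : lead_coef (P - a *: Q) != 0 by rewrite lead_coef_eq0 pencil_neq0.
have szs : size s = N.
  by apply/eqP; rewrite -eqSS -sz Ps size_scale // size_prod_XsubC.
have critF z : root (P - a *: Q) z -> wronskian.[z] != 0.
  move=> pz; apply/negP => W0; case/negP: acrit.
  have [Qz <-] := (pencil_rootP a z).1 pz; apply: map_f.
  case: (closed_field_poly_normal wronskian) W0 => t /= ->.
  by rewrite -rootE rootZ ?lead_coef_eq0 ?wronskian_neq0 // root_prod_XsubC.
have Us : uniq s.
  rewrite -separable.separable_prod_XsubC.
  rewrite -(separable.eqp_separable (eqp_scale _ lc0)) -Ps.
  rewrite separable.separable_poly.unlock.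
  apply: contraT => /closed_rootP[z]; rewrite root_gcd => /andP[pz dpz].
  case/negP: (critF z pz); move: pz dpz.
  rewrite !rootE /wronskian !hornerE !poly.derivE !hornerE.
  by rewrite !subr_eq0 => /eqP -> /eqP ->; apply/eqP; ring.
have rootsE z : root (P - a *: Q) z = (z \in s).
  by rewrite Ps rootZ // root_prod_XsubC.
pose w n := tnth (in_tuple s) (cast_ord (esym szs) n); exists w; split.
- by move=> m n /(tuple_uniqP (in_tuple s) Us) /cast_ord_inj.
- move=> z; rewrite -pencil_rootP rootsE; split=> [zs|[n ->]].
    have /tnthP[i zi] : z \in in_tuple s by [].
    by exists (cast_ord szs i); rewrite /w cast_ordK.
  exact: mem_tnth.
- by move=> n; apply: critF; rewrite rootsE mem_tnth.
Qed.
End Pencil.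

(** * The function r and the elements of L(r) *)

Section RationalCalculus.
Variables (C : numClosedFieldType) (P Q : {poly C}).

Lemma is_derive_horner (p : {poly C}) (z : C) :
  is_derive z (1 : C) (horner p) p^`().[z].
Proof.
elim/poly_ind: p => [|p c ih].
  rewrite poly.deriv0 horner0 (_ : horner 0 = cst 0).
    exact: is_derive_cst.
  by apply/funext => x; rewrite horner0.
rewrite (_ : horner (p * 'X + c%:P) = horner p * id + cst c); last first.
  by apply/funext => x; rewrite !fctE !hornerE.
apply: is_derive_eq; rewrite !poly.derivE !hornerE /GRing.scale /=; ring.
Qed.

Lemma is_derive_ratf (z : C) : Q.[z] != 0 ->
  is_derive z (1 : C) (ratf P Q) ((wronskian P Q).[z] / Q.[z] ^+ 2).
Proof.
move=> Qz.
have dP := is_derive_horner P z; have dQ := is_derive_horner Q z.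
rewrite (_ : ratf P Q = horner P * (fun x => (Q.[x])^-1)); last first.
  by [].
have dV : is_derive z (1 : C) (fun x => (Q.[x])^-1) (- Q.[z] ^- 2 *: Q^`().[z]).
  have [dQz dQE] := dQ.
  by apply: DeriveDef; [exact: derivableV | rewrite deriveV ?dQE].
apply: is_derive_eq; rewrite /wronskian !hornerE /GRing.scale /=.
by field.
Qed.

Lemma derive1_ratf (z : C) : Q.[z] != 0 ->
  derive1 (ratf P Q) z = (wronskian P Q).[z] / Q.[z] ^+ 2.
Proof. by move=> /is_derive_ratf dr; rewrite derive1E derive_val. Qed.

Lemma derivable_continuous (V : normedModType C) (f : C -> V) (z : C) :
  derivable f z 1 -> {for z, continuous f}.
Proof. by move=> /derivable1_diffP /differentiable_continuous. Qed.

Lemma continuous_horner_at (p : {poly C}) (z : C) :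
  {for z, continuous (horner p)}.
Proof. by apply: derivable_continuous; have [] := is_derive_horner p z. Qed.

Lemma continuous_ratf (z : C) : Q.[z] != 0 -> {for z, continuous (ratf P Q)}.
Proof. by move=> /is_derive_ratf[dr _]; exact: derivable_continuous. Qed.

(** The numerator [Q(a) P - P(a) Q] of the difference quotient vanishes at [a],
    so dividing it by [X - a] lowers the degree by one. *)
Lemma diffquot_poly (a : C) : Q.[a] != 0 -> (size Q <= size P)%N ->
  exists q : {poly C}, (size q <= (size P).-1)%N /\
    forall z, Q.[z] != 0 -> diffquot P Q a z = q.[z] / Q.[z].
Proof.
move=> Qa hdeg.
have /factor_theorem[s sE] : root (Q.[a] *: P - P.[a] *: Q) a.
  by rewrite rootE !hornerE mulrC subrr.
have szs : (size s <= (size P).-1)%N.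
  have [->|s0] := eqVneq s 0; first by rewrite size_poly0.
  have : (size (Q.[a] *: P - P.[a] *: Q)%R <= size P)%N.
    rewrite (leq_trans (size_polyD _ _)) // geq_max size_polyN.
    by rewrite !(leq_trans (size_scale_leq _ _)).
  rewrite sE size_Mmonic ?monicXsubC // size_XsubC addn2 /=.
  by case: (size P).
exists (Q.[a]^-1 *: s); split; first exact: leq_trans (size_scale_leq _ _) szs.
move=> z Qz; rewrite /diffquot hornerZ.
have [->|za] := eqVneq z a.
  rewrite derive1_ratf //.
  have -> : s.[a] = (Q.[a] *: P - P.[a] *: Q)^`().[a].
    by rewrite sE derivM derivXsubC !hornerE subrr mulr0 add0r.
  rewrite /wronskian derivB !derivZ hornerD hornerN !hornerM hornerD hornerN.
  by rewrite !hornerZ; field.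
have -> : s.[z] = (Q.[a] *: P - P.[a] *: Q).[z] / (z - a).
  by rewrite sE !hornerE mulfK // subr_eq0.
by rewrite /ratf hornerD hornerN !hornerZ; field; rewrite Qa Qz subr_eq0 za.
Qed.

Lemma in_L_poly (f : C -> C) : (size Q <= size P)%N -> in_L P Q f ->
  exists q : {poly C}, (size q <= (size P).-1)%N /\
    forall z, Q.[z] != 0 -> f z = q.[z] / Q.[z].
Proof.
move=> hdeg [m [a [c [Qa fE]]]].
have /choice[q qP] i := diffquot_poly (Qa i) hdeg.
exists (\sum_i c i *: q i); split.
  apply: (leq_trans (size_sum _ _ _)); apply/bigmax_leqP => i _.
  by rewrite (leq_trans (size_scale_leq _ _)) //; case: (qP i).
move=> z Qz; rewrite fE // horner_sum mulr_suml; apply: eq_bigr => i _.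
by have [_ ->//] := qP i; rewrite hornerZ mulrA.
Qed.

Lemma poly_eq0_inj_roots (N : nat) (q : {poly C}) (w : 'I_N -> C) :
  (size q <= N)%N -> injective w -> (forall n, q.[w n] = 0) -> q = 0.
Proof.
move=> szq wI qw; apply/eqP; apply: contraT => q0; move: szq; rewrite leqNgt.
suff: (size (codom w) < size q)%N by rewrite size_codom card_ord => ->.
apply: max_poly_roots => //; last exact/injectiveP.
by apply/allP => _ /codomP[n ->]; rewrite rootE qw.
Qed.

Lemma notin_near (z : C) (t : seq C) : \forall x \near z^', x \notin t.
Proof.
elim: t => [|a t ih]; first by near=> x.
near=> x; rewrite inE negb_or; apply/andP; split; last by near: x.
near: x; have [->|za] := eqVneq z a; first exact: nbhs_dnbhs_neq.
apply: nbhs_dnbhs; apply/nbhs_ballP; exists `|z - a|.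
  by rewrite /= normr_gt0 subr_eq0.
by move=> x; rewrite -ball_normE /=; apply: contraTneq => ->; rewrite ltxx.
Unshelve. all: by end_near. Qed.

Lemma poly_neq0_near (p : {poly C}) (z : C) : p != 0 ->
  \forall x \near z^', p.[x] != 0.
Proof.
move=> p0; have [s ps] := closed_field_poly_normal p.
near=> x; rewrite -[_ != 0]/(~~ root p x) ps rootZ ?lead_coef_eq0 //.
by rewrite root_prod_XsubC; near: x; exact: notin_near.
Unshelve. all: by end_near. Qed.

Lemma cvg_in_L (f : C -> C) (z : C) : (size Q <= size P)%N -> Q != 0 ->
  in_L P Q f -> Q.[z] != 0 -> f x @[x --> z^'] --> f z.
Proof.
move=> hdeg hQ /in_L_poly[//|q [_ fE]] Qz; rewrite fE //.
apply: cvg_trans (_ : (q.[x] / Q.[x]) @[x --> z^'] --> _).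
  apply: near_eq_cvg; near=> x; rewrite fE //.
  by near: x; exact: poly_neq0_near.
apply: cvg_within_filter.
by apply: cvgM; [|apply: cvgV => //]; exact: continuous_horner_at.
Unshelve. all: by end_near. Qed.
End RationalCalculus.

(** * The row Z_r tensored with the identity *)

Section Kronecker.
Variables (C : numClosedFieldType) (N p : nat) (e : 'I_N -> C -> C).

Lemma ZIE (z : C) (a : 'I_p) (k : 'I_(N * p)) :
  ZI p e z a k =
    e (mxtens.mxtens_unindex k).1 z * (a == (mxtens.mxtens_unindex k).2)%:R.
Proof.
rewrite /ZI castmxE /= cast_ord_id mxE !mxE; congr (_ * (_ == _)%:R).
by apply: val_inj => /=; rewrite modn_small.
Qed.

(** The column [c] tensored with [I_p]: right multiplication of [ZI] by it
    evaluates the element of L(r) whose coordinates are [c]. *)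
Definition coefI (c : 'I_N -> C) : 'M[C]_(N * p, p) :=
  \matrix_(k, b) (c (mxtens.mxtens_unindex k).1
                  * ((mxtens.mxtens_unindex k).2 == b)%:R).

Lemma sum_mxtens (V : nmodType) (F : 'I_N -> 'I_p -> V) :
  \sum_(k < N * p) F (mxtens.mxtens_unindex k).1 (mxtens.mxtens_unindex k).2
  = \sum_i \sum_j F i j.
Proof.
rewrite pair_big /= (reindex (@mxtens.mxtens_unindex N p)) //=.
exists (@mxtens.mxtens_index N p) => i _.
  exact: mxtens.mxtens_unindexK.
exact: mxtens.mxtens_indexK.
Qed.

Lemma ZI_mulE (q : nat) (B : 'M[C]_(N * p, q)) (z : C) (a : 'I_p) (b : 'I_q) :
  (ZI p e z *m B) a b = \sum_i e i z * B (mxtens.mxtens_index (i, a)) b.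
Proof.
rewrite mxE.
transitivity (\sum_i \sum_j
    e i z * (a == j)%:R * B (mxtens.mxtens_index (i, j)) b).
  rewrite -sum_mxtens; apply: eq_bigr => k _; rewrite ZIE.
  by rewrite -surjective_pairing mxtens.mxtens_unindexK.
apply: eq_bigr => i _; rewrite (bigD1 a) //= eqxx mulr1 big1 ?addr0 // => j ja.
by rewrite eq_sym (negPf ja) mulr0 mul0r.
Qed.

Lemma ZI_coefI (c : 'I_N -> C) (z : C) :
  ZI p e z *m coefI c = (\sum_i c i * e i z)%:M.
Proof.
apply/matrixP => a b; rewrite ZI_mulE !mxE -mulr_natr mulr_suml.
by apply: eq_bigr => i _; rewrite !mxE mxtens.mxtens_indexK /= mulrCA mulrA.
Qed.

(** Each column of [B] splits into p coordinate vectors of elements of L(r);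
    these vanish at N points, hence are zero because their numerators have degree
    less than N. *)
Lemma ZI_inj (P Q : {poly C}) (w : 'I_N -> C) (q : nat)
    (B : 'M[C]_(N * p, q)) :
    size P = N.+1 -> (size Q <= size P)%N -> basis_of_L P Q e -> injective w ->
    (forall n, Q.[w n] != 0) -> (forall n, ZI p e (w n) *m B = 0) ->
  B = 0.
Proof.
move=> hN hdeg [eL _ eI] wI Qw ZB.
apply/matrixP => k b; case: (mxtens.mxtens_indexP k) => i a; rewrite [RHS]mxE.
pose c j := B (mxtens.mxtens_index (j, a)) b.
have cE z : \sum_j c j * e j z = (ZI p e z *m B) a b.
  by rewrite ZI_mulE; apply: eq_bigr => j _; rewrite mulrC.
have /choice[g gP] j := in_L_poly hdeg (eL j).
have cgE z : Q.[z] != 0 ->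
    \sum_j c j * e j z = (\sum_j c j *: g j).[z] / Q.[z].
  move=> Qz; rewrite horner_sum mulr_suml; apply: eq_bigr => j _.
  by have [_ ->//] := gP j; rewrite hornerZ mulrA.
suff cg0 : \sum_j c j *: g j = 0.
  by apply: (eI c) => z Qz; rewrite cgE // cg0 horner0 mul0r.
apply: (poly_eq0_inj_roots _ wI) => [|n].
  apply: (leq_trans (size_sum _ _ _)); apply/bigmax_leqP => j _.
  by rewrite (leq_trans (size_scale_leq _ _)) //; have [] := gP j; rewrite hN.
apply/eqP; have /eqP := cgE _ (Qw n).
by rewrite cE ZB mxE eq_sym mulf_eq0 invr_eq0 (negPf (Qw n)) orbF.
Qed.
End Kronecker.

(** * Circles, and the open set A *)

Section Circles.
Variable C : numClosedFieldType.

Lemma circle_dist (c rho s w : C) : 0 < rho -> circle c rho s ->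
  `| `|w - c| - rho| <= `|s - w|.
Proof.
move=> rho0 /= cs; rewrite -cs distrC.
by rewrite (le_trans (ler_dist_dist _ _)) // opprB addrA subrK.
Qed.

Lemma circle_horner_le (c rho : C) (p : {poly C}) : 0 < rho ->
  exists2 B : C, 0 < B & forall s, circle c rho s -> `|p.[s]| <= B.
Proof.
move=> rho0.
exists (1 + \sum_(i < size p) `|p`_i| * (`|c| + rho) ^+ i).
  rewrite ltr_pwDl // sumr_ge0 // => i _.
  by rewrite mulr_ge0 // exprn_ge0 // addr_ge0 // ltW.
move=> s /= cs; rewrite horner_coef ler_wpDl //.
apply: (le_trans (ler_norm_sum _ _ _)); apply: ler_sum => i _.
rewrite normrM normrX ler_wpM2l // lerXn2r ?nnegrE ?addr_ge0 // ?(ltW rho0) //.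
by rewrite -cs -[s in leLHS](subrK c) addrC ler_normD.
Qed.

(** Factoring [p] bounds it below by the product of the distances of its roots
    to the circle. *)
Lemma circle_horner_ge (c rho : C) (p : {poly C}) : 0 < rho ->
  (forall s, circle c rho s -> p.[s] != 0) -> p != 0 ->
  exists2 d : C, 0 < d & forall s, circle c rho s -> d <= `|p.[s]|.
Proof.
move=> rho0 ncs p0; have [r pE] := closed_field_poly_normal p.
exists (`|lead_coef p| * \prod_(w <- r) `| `|w - c| - rho|).
  rewrite mulr_gt0 ?normr_gt0 ?lead_coef_eq0 // big_seq prodr_gt0 // => w wr.
  rewrite normr_gt0 subr_eq0; apply/eqP => /(ncs w) /negP; apply.
  by rewrite -[_ == 0]/(root p w) pE rootZ ?lead_coef_eq0 // root_prod_XsubC.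
move=> s cs; rewrite {2}pE hornerZ normrM ler_wpM2l //.
rewrite horner_prod normr_prod; apply: ler_prod => w _.
by rewrite hornerXsubC normr_ge0 circle_dist.
Qed.
End Circles.

Section DiskSystem.
Variables (C : numClosedFieldType) (P Q : {poly C}) (N L : nat).
Variables (ctr rad : 'I_L -> C).
Hypotheses (hN : size P = N.+1) (hN0 : (0 < N)%N).
Hypotheses (hPQ : coprimep P Q) (hQ : Q != 0).
Hypothesis hdisks : disk_system P Q ctr rad.

Lemma circle_nopole l s : circle (ctr l) (rad l) s -> Q.[s] != 0.
Proof. by move=> cs; apply: (ds_nopole hdisks (l := l)); right. Qed.

(** If [a] is not a value of [r] on the circle, then [P - a Q] is bounded away
    from zero there; for [x = r(s)] its value at [s] is [(x - a) Q(s)], which is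
    too small when [x] is close to [a]. *)
Lemma Aset_nbhs (a : C) : Aset P Q ctr rad a -> nbhs a (Aset P Q ctr rad).
Proof.
move=> Aa; rewrite /Aset /setC /bigcup /=.
pose avoids l x := forall s, circle (ctr l) (rad l) s -> ratf P Q s <> x.
suff: \forall x \near a, forall l, avoids l x.
  apply: (@filterS _ (nbhs a)) => x xP [l _ [s cs sx]].
  exact: xP cs sx.
apply: (@filter_forall C _ avoids (nbhs a) _) => l; rewrite /avoids.
have r0 := ds_rad hdisks l.
have nz s : circle (ctr l) (rad l) s -> (P - a *: Q).[s] != 0.
  move=> cs; rewrite pencil_rootE ?(circle_nopole cs) //; apply/eqP => sa.
  by apply: Aa; exists l => //; exists s.
have [d d0 dP] := circle_horner_ge r0 nz (pencil_neq0 hN hN0 hPQ a).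
have [B B0 BQ] := circle_horner_le (ctr l) Q r0.
apply/nbhs_ballP; exists (d / B); first by rewrite /= divr_gt0.
move=> x; rewrite -ball_normE /= => ax s cs sx.
have : d <= `|a - x| * B.
  apply: (le_trans (dP _ cs)).
  have -> : (P - a *: Q).[s] = (x - a) * Q.[s].
    rewrite -sx /ratf hornerD hornerN hornerZ.
    by have := circle_nopole cs => Qs; field.
  by rewrite normrM distrC ler_wpM2l // BQ.
move: ax; rewrite ltr_pdivlMr // => ax /le_lt_trans/(_ ax).
by rewrite ltxx.
Qed.

Lemma ratf_circle_bounded :
  exists2 B : C, 0 <= B &
    forall l s, circle (ctr l) (rad l) s -> `|ratf P Q s| <= B.
Proof.
have /choice[b bP] l : exists b : C, 0 <= b /\
    forall s, circle (ctr l) (rad l) s -> `|ratf P Q s| <= b.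
  have r0 := ds_rad hdisks l.
  have [B B0 BP] := circle_horner_le (ctr l) P r0.
  have [d d0 dQ] := circle_horner_ge r0 (@circle_nopole l) hQ.
  exists (B / d); split; first by rewrite divr_ge0 // ltW.
  move=> s cs; rewrite normrM normfV ler_pM // ?invr_ge0 // ?BP //.
  by rewrite lef_pV2 ?posrE ?dQ // (lt_le_trans d0) // dQ.
exists (\sum_l b l) => [|l s cs].
  by rewrite sumr_ge0 // => l _; case: (bP l).
rewrite (bigD1 l) //= ler_wpDr //; last by case: (bP l) => _; apply.
by rewrite sumr_ge0 // => k _; case: (bP k).
Qed.
End DiskSystem.

(** Exceeding both the values of [r] on the circles and the elements of [E] in
    modulus is enough. *)
Lemma Aset_nat (R : realType) (P Q : {poly Cplx R}) (L : nat)
    (ctr rad : 'I_L -> Cplx R) (E : seq (Cplx R)) : Q != 0 ->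
    disk_system P Q ctr rad ->
  exists k : nat, Aset P Q ctr rad k%:R /\ k%:R \notin E.
Proof.
move=> hQ hdisks.
have [B B0 BP] := ratf_circle_bounded hQ hdisks.
pose T : Cplx R := B + \sum_(z <- E) `|z|.
have T0 : 0 <= T by rewrite addr_ge0 // sumr_ge0.
have [k kT] : exists k : nat, T < k%:R.
  move: T0; case: T => a b; rewrite lecE /= => /andP[/eqP b0 a0].
  exists (Num.truncn a).+1.
  rewrite -(rmorph_nat (real_complex R)) ltcE /= b0 eqxx /=.
  exact: Num.Theory.truncnS_gt.
exists k; split.
  move=> [l _ [s cs sk]]; have := BP l s cs; rewrite sk normr_nat => kB.
  suff : T < T by rewrite ltxx.
  by rewrite (lt_le_trans kT) // (le_trans kB) // ler_wpDr // sumr_ge0.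
apply/negP => kE; suff : T < T by rewrite ltxx.
rewrite (lt_le_trans kT) // /T (big_rem _ kE) /= normr_nat.
by rewrite addrCA ler_wpDr // addr_ge0 // sumr_ge0.
Qed.

(** * The resolvent-like operator R_beta as an interpolation remainder *)

Section BackwardShift.
Variables (C : numClosedFieldType) (P Q : {poly C}) (N p : nat).
Variables (e : 'I_N -> C -> C).
Hypothesis he : basis_of_L P Q e.
Variables (beta : C) (w : 'I_N -> C).
Hypothesis w_inj : injective w.
Hypothesis w_level : forall z, level_set P Q beta z <-> exists n, z = w n.
Hypothesis w_simple : forall n, (wronskian P Q).[w n] != 0.

Let w_in n : level_set P Q beta (w n).
Proof. by apply/w_level; exists n. Qed.

Let Qw n : Q.[w n] != 0. Proof. by have [] := w_in n. Qed.

Let rw n : ratf P Q (w n) = beta. Proof. by have [] := w_in n. Qed.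

Let dr n : derive1 (ratf P Q) (w n) != 0.
Proof. by rewrite derive1_ratf // mulf_neq0 // invr_eq0 expf_neq0. Qed.

Lemma diffquot_in_L (a : C) : Q.[a] != 0 -> in_L P Q (diffquot P Q a).
Proof.
move=> Qa; exists 1%N, (fun=> a), (fun=> 1); split=> // z _.
by rewrite big_ord1 mul1r.
Qed.

(** The interpolation functions [l_n] are multiples of difference quotients of
    [r] at the nodes, hence have coordinates in the basis [e]. *)
Lemma interpolation_matrices : exists X : 'I_N -> 'M[C]_(N * p, p),
  forall n z, Q.[z] != 0 ->
    ZI p e z *m X n = (diffquot P Q (w n) z / derive1 (ratf P Q) (w n))%:M.
Proof.
have [_ eL _] := he.
have /choice[c cE] n := eL _ (diffquot_in_L (Qw n)).
exists (fun n => coefI p (fun i => c n i / derive1 (ratf P Q) (w n))) => n z Qz.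
rewrite ZI_coefI cE // mulr_suml; congr _%:M; apply: eq_bigr => i _.
by rewrite mulrAC.
Qed.

Lemma sum_level_set (V : zmodType) (F : C -> V) :
  \sum_(z \in level_set P Q beta) F z = \sum_n F (w n).
Proof.
have -> : level_set P Q beta = [set` map w (index_enum 'I_N)].
  apply/seteqP; split=> z /=.
    by move=> /w_level[n ->]; rewrite map_f // mem_index_enum.
  by move=> /mapP[n _ ->]; exact: w_in.
by rewrite -fsbig_seq ?map_inj_uniq ?index_enum_uniq // big_map.
Qed.

Variable X : 'I_N -> 'M[C]_(N * p, p).
Hypothesis XE : forall n z, Q.[z] != 0 ->
    ZI p e z *m X n = (diffquot P Q (w n) z / derive1 (ratf P Q) (w n))%:M.

(** For [r z != beta] the sum in the definition of R_beta is
    [sum_n l_n(z) f(w_n)] divided by [r z - beta]. *)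
Lemma Rop_interpolation (f : C -> 'cV[C]_p) (z : C) :
    Q.[z] != 0 -> ratf P Q z != beta ->
  Rop P Q beta f z =
    (ratf P Q z - beta)^-1 *: (f z - ZI p e z *m \sum_n X n *m f (w n)).
Proof.
move=> Qz rz; rewrite /Rop (negPf rz) /Rformula sum_level_set scalerBr.
congr (_ - _); rewrite mulmx_sumr scaler_sumr; apply: eq_bigr => n _.
rewrite mulmxA XE // mul_scalar_mx scalerA; congr (_ *: _).
have zw : z != w n by apply: contra_neq rz => ->.
rewrite /diffquot (negPf zw) rw; field.
by rewrite dr !subr_eq0 rz zw.
Qed.

(** This is what makes the kernel identity hold also at the roots of
    [r = beta], where R_beta is given by a limit. *)
Lemma interpolation_node (q : nat) (f : C -> 'M[C]_(p, q)) (m : 'I_N) :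
  ZI p e (w m) *m \sum_n X n *m f (w n) = f (w m).
Proof.
rewrite mulmx_sumr (bigD1 m) //= big1 => [|n nm].
  by rewrite addr0 mulmxA XE // /diffquot eqxx divff // mul1mx.
rewrite mulmxA XE // /diffquot ifF; last first.
  by apply/negbTE; apply: contra_neq nm => /w_inj.
by rewrite !rw subrr !mul0r mul_scalar_mx scale0r.
Qed.
End BackwardShift.

(** * The kernel identity *)

Lemma on_domE (C : numClosedFieldType) (p : nat) (U : set C)
  (f : C -> 'cV[C]_p) z : U z -> on_dom U f z = f z.
Proof. by move=> Uz; rewrite /on_dom /patch mem_set. Qed.

Lemma eq_mx_forms (C : numClosedFieldType) (m n : nat) (A B : 'M[C]_(m, n)) :
  (forall (c : 'cV[C]_m) (d : 'cV[C]_n),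
     (c^t* *m A *m d) 0 0 = (c^t* *m B *m d) 0 0) -> A = B.
Proof.
move=> AB; apply/matrixP => i j; have := AB (delta_mx i 0) (delta_mx j 0).
have -> : (delta_mx i (0 : 'I_1))^t* = delta_mx (0 : 'I_1) i :> 'M[C]_(1, m).
  by apply/matrixP => a b; rewrite !mxE rmorph_nat andbC.
by rewrite -!rowE -!colE !mxE.
Qed.

Lemma form_trmxC (C : numClosedFieldType) (m n : nat) (B : 'M[C]_(m, n))
    (c : 'cV[C]_m) (d : 'cV[C]_n) :
  (d^t* *m B^t* *m c) 0 0 = ((c^t* *m (B *m d)) 0 0)^*.
Proof.
have -> : d^t* *m B^t* *m c = (c^t* *m (B *m d))^t*.
  by rewrite !trmxC_mul trmxCK.
by rewrite !mxE.
Qed.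

Section KernelIdentity.
Variables (C : numClosedFieldType) (P Q : {poly C}) (N p : nat).
Variables (e : 'I_N -> C -> C) (A : set C).
Variables (H : set (C -> 'cV[C]_p)).
Variables (ip : (C -> 'cV[C]_p) -> (C -> 'cV[C]_p) -> C).
Variables (K : C -> C -> 'M[C]_p).
Let U := ratf_preimage P Q A.
Hypothesis ip_herm : forall f g, H f -> H g -> ip g f = (ip f g)^*.
Hypothesis hK : reproducing_kernel U H ip K.

Let ker z (c : 'cV[C]_p) := on_dom U (fun x => K x z *m c).

Let kerH z c : U z -> H (ker z c).
Proof. by move=> Uz; have [] := hK c Uz. Qed.

Let ip_ker f z c : H f -> U z -> ip f (ker z c) = (c^t* *m f z) 0 0.
Proof. by move=> Hf Uz; have [_] := hK c Uz; apply. Qed.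

Lemma kernel_herm z w : U z -> U w -> (K w z)^t* = K z w.
Proof.
move=> Uz Uw; apply: eq_mx_forms => d c.
have Hc := kerH c Uw; have Hd := kerH d Uz.
have := ip_herm Hc Hd; rewrite !ip_ker // /ker !on_domE //.
by rewrite form_trmxC => ->; rewrite conjCK mulmxA.
Qed.

Variables (beta : C) (w : 'I_N -> C).
Hypothesis w_inj : injective w.
Hypothesis w_level : forall z, level_set P Q beta z <-> exists n, z = w n.
Hypothesis w_simple : forall n, (wronskian P Q).[w n] != 0.
Hypothesis beta_real : beta^* = beta.
Hypothesis Abeta : A beta.
Hypothesis hinv : forall f, H f -> H (on_dom U (Rop P Q beta f)).
Hypothesis Rop_sym : forall f g, H f -> H g ->
  ip f (on_dom U (Rop P Q beta g)) = ip (on_dom U (Rop P Q beta f)) g.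

Variable X : 'I_N -> 'M[C]_(N * p, p).
Hypothesis XE : forall n z, Q.[z] != 0 ->
    ZI p e z *m X n = (diffquot P Q (w n) z / derive1 (ratf P Q) (w n))%:M.

Let Uw n : U (w n).
Proof.
have [Qw rw] : level_set P Q beta (w n) by apply/w_level; exists n.
by split=> //; rewrite rw.
Qed.

(* S z collects the interpolation data of the kernel functions at z: on K(.,z)c
   the remainder R_beta subtracts ZI *m (S z *m c). *)
Let S z : 'M[C]_(N * p, p) := \sum_n X n *m K (w n) z.

Let Rop_ker y (c : 'cV[C]_p) z : U y -> U z -> ratf P Q z != beta ->
  on_dom U (Rop P Q beta (ker y c)) z =
  (ratf P Q z - beta)^-1 *: ((K z y - ZI p e z *m S y) *m c).
Proof.
move=> Uy Uz rz; rewrite on_domE //.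
rewrite (Rop_interpolation w_inj w_level w_simple XE) //.
  rewrite /ker on_domE // mulmxBl -mulmxA mulmx_suml; congr (_ *: (_ - _ *m _)).
  by apply: eq_bigr => n _; rewrite on_domE // mulmxA.
by case: Uz.
Qed.

(** Both sides represent the form [R_beta K(.,y)c, K(.,z)d]: the left one by
    the reproducing property, the right one after moving R_beta to the other
    argument. *)
Lemma kernel_shift_sym z y : U z -> U y ->
    ratf P Q z != beta -> ratf P Q y != beta ->
  (ratf P Q z - beta)^-1 *: (K z y - ZI p e z *m S y) =
  ((ratf P Q y - beta)^-1 *: (K y z - ZI p e y *m S z))^t*.
Proof.
move=> Uz Uy rz ry; apply: eq_mx_forms => d c.
have Hf := kerH c Uy; have Hg := kerH d Uz.
have := Rop_sym Hf Hg.
rewrite (ip_herm (hinv Hg) Hf) !ip_ker //; try exact: hinv.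
by rewrite !Rop_ker // !scalemxAl form_trmxC !mulmxA => ->.
Qed.

Variable M : 'I_N -> C -> 'M[C]_(N * p, p).
Hypothesis ME : forall n z, U z -> K z (w n) = ZI p e z *m M n (ratf P Q z).

(** Chosen so that [ZI z *m Nfun (r z)] is [(r z - beta) *: (S z)^t*].  The
    additive constant left free by the kernel identity is fixed by
    [Nfun beta = 0]. *)
Definition Nfun (l : C) : 'M[C]_(N * p) :=
  \sum_n (l - beta) *: (M n l *m (X n)^t*).

Lemma ZI_Nfun z : U z ->
  ZI p e z *m Nfun (ratf P Q z) = (ratf P Q z - beta) *: (S z)^t*.
Proof.
move=> Uz; rewrite /Nfun /S -scaler_sumr -scalemxAr; congr (_ *: _).
rewrite mulmx_sumr raddf_sum /= map_mx_sum.
by apply: eq_bigr => n _; rewrite trmxC_mul kernel_herm // ME // mulmxA.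
Qed.

(** Clearing denominators in the symmetry relation gives the identity when
    neither [r z] nor [r y] equals [beta]; if one of them does, one of the
    two interpolation sums reproduces [K z y] exactly. *)
Lemma kernel_identity z y : U z -> U y ->
  (ratf P Q z - (ratf P Q y)^*) *: K z y =
  ZI p e z *m (Nfun (ratf P Q z) - (Nfun (ratf P Q y))^t*) *m (ZI p e y)^t*.
Proof.
move=> Uz Uy.
rewrite mulmxBr mulmxBl ZI_Nfun // -mulmxA -trmxC_mul ZI_Nfun //.
rewrite trmxCZ trmxCK -scalemxAl -scalemxAr -trmxC_mul.
have -> : ratf P Q z - (ratf P Q y)^* =
          (ratf P Q z - beta) - (ratf P Q y - beta)^*.
  by rewrite rmorphB /= beta_real; ring.
have node x v : U x -> U v -> ratf P Q x - beta = 0 ->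
    ZI p e x *m S v = K x v.
  move=> [Qx _] Uv /eqP; rewrite subr_eq0 => /eqP rx.
  have [n ->] : exists n, x = w n by apply/w_level.
  exact: (interpolation_node w_inj w_level w_simple XE (K^~ v)).
have [a0|a0] := eqVneq (ratf P Q z - beta) 0.
  by rewrite (node z y) // a0 scale0r !sub0r scaleNr.
have [b0|b0] := eqVneq (ratf P Q y - beta) 0.
  by rewrite (node y z) // b0 rmorph0 scale0r !subr0 kernel_herm.
have rz : ratf P Q z != beta by rewrite -subr_eq0.
have ry : ratf P Q y != beta by rewrite -subr_eq0.
have := kernel_shift_sym Uz Uy rz ry.
rewrite trmxCZ trmxCB kernel_herm //.
(* The symmetry relation is (K - ZI S) / a = (K - T) / conj b. *)
set T := (ZI p e y *m S z)^t*.
move: a0 b0; move: (ratf P Q z - beta) (ratf P Q y - beta) => a b a0 b0.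
move=> /(congr1 (fun B => (a * b^*) *: B)); rewrite !scalerA.
rewrite mulrAC divff // fmorphV mulfK ?conjC_eq0 // mul1r !scalerBr.
move=> /eqP; rewrite subr_eq addrAC eq_sym subr_eq => /eqP KT.
by apply/eqP; rewrite scalerBl subr_eq addrAC [a *: T + _]addrC -KT addrK.
Qed.

Lemma Nfun_analytic : (forall n, analytic_on A (M n)) -> analytic_on A Nfun.
Proof.
move=> Man z Az; apply/derivable_mx => i j.
rewrite (_ : (fun l => Nfun l i j) =
  \sum_n ((id - cst beta) *
    \sum_k ((fun l => M n l i k) * cst ((X n)^t* k j)))).
  apply: derivable_sum => n; apply: derivableM.
    by apply: derivableB; [exact: derivable_id | exact: derivable_cst].
  apply: derivable_sum => k; apply: derivableM; last exact: derivable_cst.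
  by have /derivable_mx := Man n z Az.
apply/funext => l; rewrite /Nfun summxE fct_sumE; apply: eq_bigr => n _.
by rewrite mxE mxE mulrfctE fct_sumE.
Qed.

End KernelIdentity.

(** * Points with conjugate values under r *)

Section ConjugateValues.
Variables (C : numClosedFieldType) (P Q : {poly C}) (N p : nat).
Variables (e : 'I_N -> C -> C) (A : set C).
Let U := ratf_preimage P Q A.
Hypotheses (hN : size P = N.+1) (hN0 : (0 < N)%N).
Hypotheses (hPQ : coprimep P Q) (hdeg : (size Q <= size P)%N) (hQ : Q != 0).
Hypothesis he : basis_of_L P Q e.
Hypothesis A_open : forall a, A a -> nbhs a A.
Variable Nf : C -> 'M[C]_(N * p).
Hypothesis Nf_an : analytic_on A Nf.

Lemma ratf_preimage_near z : U z -> \forall x \near z^', U x.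
Proof.
move=> [Qz Az]; near=> x; split; first by near: x; exact: poly_neq0_near.
near: x; apply: nbhs_dnbhs; have cr := continuous_ratf (P := P) Qz.
exact: (cr _ (A_open Az)).
Unshelve. all: by end_near. Qed.

Lemma ratf_neq_near z : Q.[z] != 0 ->
  \forall x \near z^', ratf P Q x != ratf P Q z.
Proof.
move=> Qz; near=> x; have Qx : Q.[x] != 0 by near: x; exact: poly_neq0_near.
rewrite -(pencil_rootE P (ratf P Q z) Qx); near: x.
exact: poly_neq0_near (pencil_neq0 hN hN0 hPQ _).
Unshelve. all: by end_near. Qed.

Lemma cvg_ZI z : Q.[z] != 0 -> ZI p e x @[x --> z^'] --> ZI p e z.
Proof.
move=> Qz; apply/cvg_mxP => i k; under eq_fun do rewrite ZIE.
rewrite ZIE; apply: cvgM; last exact: cvg_cst.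
by have [eL _ _] := he; exact: (cvg_in_L hdeg hQ (eL _) Qz).
Qed.

(** For non-exceptional [mu] and [mu^*] the compressions to N preimages on each
    side determine the matrix; the remaining points of [A] are reached by
    continuity, the exceptional values being isolated. *)
Lemma symmetric_of_compressions :
    (forall z y, U z -> U y -> ratf P Q z = (ratf P Q y)^* ->
       ZI p e z *m (Nf (ratf P Q z) - (Nf (ratf P Q y))^t*)
         *m (ZI p e y)^t* = 0) ->
  forall mu, A mu -> A mu^* -> Nf mu = (Nf mu^*)^t*.
Proof.
move=> compr mu Amu Amu'.
have generic l : A l -> A l^* -> l \notin exceptional P Q N ->
    l^* \notin exceptional P Q N -> Nf l = (Nf l^*)^t*.
  move=> Al Al' /(exceptionalP hN hN0 hPQ hdeg)[w [wI wE _]].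
  move=> /(exceptionalP hN hN0 hPQ hdeg)[v [vI vE _]].
  have wP n : level_set P Q l (w n) by apply/wE; exists n.
  have vP n : level_set P Q l^* (v n) by apply/vE; exists n.
  apply/eqP; rewrite -subr_eq0 -[_ - _]trmxCK; apply/eqP.
  rewrite [X in X^t*](ZI_inj (B := (Nf l - (Nf l^*)^t*)^t*) hN hdeg he vI).
  - by rewrite trmx0 map_mx0.
  - by move=> n; have [] := vP n.
  move=> m; rewrite -[LHS]trmxCK trmxC_mul trmxCK.
  rewrite (ZI_inj (B := (Nf l - (Nf l^*)^t*) *m (ZI p e (v m))^t*)
    hN hdeg he wI).
  - by rewrite trmx0 map_mx0.
  - by move=> n; have [] := wP n.
  move=> n; have [Qw rw] := wP n; have [Qv rv] := vP m.
  rewrite mulmxA -{1}rw -rv; apply: compr; first by split=> //; rewrite rw.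
    by split=> //; rewrite rv.
  by rewrite rw rv conjCK.
have cvgN : Nf l @[l --> mu^'] --> Nf mu.
  by apply: cvg_within_filter; exact: (derivable_continuous (Nf_an Amu)).
have cvgN' : (Nf l^*)^t* @[l --> mu^'] --> (Nf mu^*)^t*.
  apply: cvg_within_filter; apply/cvg_mxP => i j; rewrite !mxE.
  under eq_fun do rewrite !mxE.
  have cN := derivable_continuous (Nf_an Amu').
  have cNc : Nf l^* @[l --> mu] --> Nf mu^*.
    exact: (cvg_comp _ _ (@conj_continuous C mu) cN).
  have cNji : Nf l^* j i @[l --> mu] --> Nf mu^* j i.
    exact: ((cvg_mxP _ _ _).1 cNc j i).
  exact: (cvg_comp _ _ cNji (@conj_continuous C (Nf mu^* j i))).
apply: (cvg_unique (@norm_hausdorff _ _) cvgN); apply: cvg_trans cvgN'.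
apply: near_eq_cvg; near=> l; apply/esym/generic.
- by near: l; exact/nbhs_dnbhs/A_open.
- by near: l; apply: nbhs_dnbhs; exact: (@conj_continuous C mu _ (A_open Amu')).
- by near: l; exact: notin_near.
- suff: l \notin map Num.conj (exceptional P Q N).
    by apply: contra => lE; rewrite -[l]conjCK; apply: map_f.
  by near: l; exact: notin_near.
Unshelve. all: by end_near. Qed.

(** The kernel is continuous in its first argument, and at points [x -> z] with
    [r x != r z] it is given by the quotient [nquot], whose limit is the
    derivative of [Nf]. *)
Lemma kernel_coincidence (K : C -> C -> 'M[C]_p) z y : U z -> U y ->
    (forall c : 'cV[C]_p, K x y *m c @[x --> z^'] --> K z y *m c) ->
    (forall x, U x -> (ratf P Q x - (ratf P Q y)^*) *: K x y =
      ZI p e x *m (Nf (ratf P Q x) - (Nf (ratf P Q y))^t*) *m (ZI p e y)^t*) ->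
    Nf (ratf P Q z) = (Nf (ratf P Q y))^t* -> ratf P Q z = (ratf P Q y)^* ->
  exists2 T : 'M[C]_(N * p),
    nquot Nf l (ratf P Q y) @[l --> (ratf P Q z)^'] --> T
    & K z y = ZI p e z *m T *m (ZI p e y)^t*.
Proof.
move=> Uz Uy Kc Kid Nzy rzy.
have [Qz Az] := Uz.
have slope : nquot Nf l (ratf P Q y) @[l --> (ratf P Q z)^'] -->
    'D_1 Nf (ratf P Q z).
  rewrite /nquot -rzy -Nzy; exact: (derivable_cvg_slope (Nf_an Az)).
exists ('D_1 Nf (ratf P Q z)) => //.
have rz' : ratf P Q x @[x --> z^'] --> (ratf P Q z)^'.
  apply: cvg_punctured (ratf_neq_near Qz).
  by apply: cvg_within_filter; exact: (continuous_ratf (P := P) Qz).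
have Kl : ZI p e x *m nquot Nf (ratf P Q x) (ratf P Q y) *m (ZI p e y)^t*
    @[x --> z^'] --> ZI p e z *m 'D_1 Nf (ratf P Q z) *m (ZI p e y)^t*.
  apply: cvg_mulmx; last exact: cvg_cst.
  by apply: cvg_mulmx; [exact: cvg_ZI | exact: cvg_comp rz' slope].
have Keq (d : 'cV[C]_p) :
    K z y *m d = ZI p e z *m 'D_1 Nf (ratf P Q z) *m (ZI p e y)^t* *m d.
  apply: (cvg_unique (@norm_hausdorff _ _) (Kc d)).
  have dd : (fun=> d) @ z^' --> d by exact: cvg_cst.
  apply: cvg_trans (cvg_mulmx Kl dd); apply: near_eq_cvg.
  near=> x; congr (_ *m d).
  have Ux : U x by near: x; exact: ratf_preimage_near.
  have rx : ratf P Q x - (ratf P Q y)^* != 0.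
    by rewrite -rzy subr_eq0; near: x; exact: ratf_neq_near.
  rewrite /nquot -scalemxAr -scalemxAl -Kid // scalerA mulVf //.
  by rewrite scale1r.
apply/matrixP => i j; have /matrixP/(_ i 0) := Keq (delta_mx j 0).
by rewrite -!colE !mxE.
Unshelve. all: by end_near. Qed.
End ConjugateValues.

Theorem theorem11p3 (R : realType) (N L p : nat) (P Q : {poly Cplx R})
    (e : 'I_N -> Cplx R -> Cplx R) (ctr rad : 'I_L -> Cplx R)
    (A U : set (Cplx R))
    (H : set (Cplx R -> 'cV[Cplx R]_p))
    (ip : (Cplx R -> 'cV[Cplx R]_p) -> (Cplx R -> 'cV[Cplx R]_p) -> Cplx R)
    (K : Cplx R -> Cplx R -> 'M[Cplx R]_p)
    (hN : size P = N.+1) (hN0 : (0 < N)%N)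
    (hPQ : coprimep P Q) (hdeg : (size Q <= size P)%N) (hQ : Q != 0)
    (he : basis_of_L P Q e)
    (hdisks : disk_system P Q ctr rad)
    (hA : A = Aset P Q ctr rad)
    (hU : U = ratf_preimage P Q A)
    (hH : pontryagin_space H ip)
    (hfun : forall f, H f -> admissible P Q e A f)
    (hK : reproducing_kernel U H ip K)
    (hinv : forall alpha, Omega P Q N alpha -> A alpha ->
       forall f, H f -> H (on_dom U (Rop P Q alpha f)))
    (hid : forall alpha beta, Omega P Q N alpha -> A alpha ->
       Omega P Q N beta -> A beta -> forall f g, H f -> H g ->
       ip f (on_dom U (Rop P Q beta g)) - ip (on_dom U (Rop P Q alpha f)) g
       + (alpha - beta^*) *
         ip (on_dom U (Rop P Q alpha f)) (on_dom U (Rop P Q beta g)) = 0) :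
  exists Nf : Cplx R -> 'M[Cplx R]_(N * p),
    analytic_on A Nf /\
    forall z w, U z -> U w ->
      (ratf P Q z != (ratf P Q w)^* ->
         K z w = ZI p e z *m nquot Nf (ratf P Q z) (ratf P Q w) *m (ZI p e w) ^t*)
      /\
      (ratf P Q z = (ratf P Q w)^* ->
         exists2 T : 'M[Cplx R]_(N * p),
           nquot Nf lambda (ratf P Q w) @[lambda --> (ratf P Q z)^'] --> T
         & K z w = ZI p e z *m T *m (ZI p e w) ^t*).
Proof.
have [k [Ak kE]] := Aset_nat (exceptional P Q N) hQ hdisks.
set beta : Cplx R := k%:R in Ak kE.
have beta_real : beta^* = beta by rewrite /beta rmorph_nat.
have [w [wI wE wW]] := exceptionalP hN hN0 hPQ hdeg kE.
have w_level n : level_set P Q beta (w n) by apply/wE; exists n.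
have Abeta : A beta by rewrite hA.
have Obeta : Omega P Q N beta by exists w.
have A_open a : A a -> nbhs a A.
  by rewrite hA; exact: (Aset_nbhs hN hN0 hPQ).
have ip_herm f g : H f -> H g -> ip g f = (ip f g)^*.
  by have [_ [_ +] _] := hH; apply.
subst U.
have Hshift f : H f -> H (on_dom (ratf_preimage P Q A) (Rop P Q beta f)).
  exact: hinv.
have Rop_sym f g : H f -> H g ->
    ip f (on_dom (ratf_preimage P Q A) (Rop P Q beta g)) =
    ip (on_dom (ratf_preimage P Q A) (Rop P Q beta f)) g.
  move=> Hf Hg; have := hid _ _ Obeta Abeta Obeta Abeta _ _ Hf Hg.
  by rewrite beta_real subrr mul0r addr0 => /eqP; rewrite subr_eq0 => /eqP.
have Uw n : ratf_preimage P Q A (w n).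
  by have [Qw rw] := w_level n; split; rewrite ?rw.
have [X XE] := interpolation_matrices p he wE.
have kerH z c : ratf_preimage P Q A z ->
    H (on_dom (ratf_preimage P Q A) (fun x => K x z *m c)).
  by move=> Uz; have [] := hK z c Uz.
have /choice[F FE] : forall nj : 'I_N * 'I_p,
    exists F : Cplx R -> 'cV[Cplx R]_(N * p), analytic_on A F /\
    forall z, ratf_preimage P Q A z ->
      K z (w nj.1) *m delta_mx nj.2 0 = ZI p e z *m F (ratf P Q z).
  move=> [n j]; have [_ _ [F [Fan FE]]] := hfun _ (kerH _ (delta_mx j 0) (Uw n)).
  by exists F; split=> // z Uz; rewrite -FE // on_domE.
pose M n l : 'M[Cplx R]_(N * p, p) := \matrix_(i, j) F (n, j) l i 0.
have ME n z : ratf_preimage P Q A z -> K z (w n) = ZI p e z *m M n (ratf P Q z).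
  move=> Uz; apply/matrixP => i j.
  have [_ /(_ z Uz) /matrixP/(_ i 0)] := FE (n, j).
  rewrite -colE !mxE => ->; by apply: eq_bigr => l _; rewrite !mxE.
pose Nf := Nfun beta X M.
have Nf_an : analytic_on A Nf.
  apply: Nfun_analytic => n l Al; apply/derivable_mx => i j.
  have [/(_ l Al) /derivable_mx/(_ i 0) dF _] := FE (n, j).
  by rewrite (_ : (fun x => M n x i j) = (fun x => F (n, j) x i 0)) //;
    apply/funext => x; rewrite mxE.
have Kid := kernel_identity ip_herm hK wI wE wW beta_real Abeta Hshift
  Rop_sym XE ME.
have Nsym := symmetric_of_compressions hN hN0 hPQ hdeg he A_open Nf_an.
exists Nf; split=> // z y Uz Uy; split=> [rzy|rzy].
  rewrite /nquot -scalemxAr -scalemxAl -Kid // scalerA mulVf ?subr_eq0 //.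
  by rewrite scale1r.
apply: (kernel_coincidence hN hN0 hPQ hdeg hQ he A_open Nf_an Uz Uy) => //.
- move=> c; have [_ an _] := hfun _ (kerH y c Uy).
  have cont := derivable_continuous (an z Uz).
  rewrite -(on_domE (fun x => K x y *m c) Uz).
  apply: cvg_trans (cvg_within_filter _ cont); apply: near_eq_cvg.
  by near=> x; rewrite on_domE //; near: x; exact: ratf_preimage_near.
- by move=> x Ux; exact: Kid.
- have [_ Az] := Uz; have [_ Ay] := Uy.
  have ryz : ratf P Q y = (ratf P Q z)^* by rewrite rzy conjCK.
  rewrite ryz; apply: Nsym; [|exact: Az|by rewrite -ryz].
  by move=> x v Ux Uv rxv; rewrite -(Kid _ _ Ux Uv) rxv subrr scale0r.
Unshelve. all: by end_near. Qed.
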